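(* Suppose that $\mathcal{B}$ is invertible and that $\mathcal{S}=\mathcal{C}\mathcal{B}^{-1}\mathcal{C}^T+\mathcal{D}$ is positive definite. Then $$\rho\bigl(I-\mathcal{S}_{\mathrm{diag}}^{-1}\mathcal{S}\bigr)<1,$$ where $\rho$ denotes the spectral radius.
   Context: Let $\mathbb{D}=(\mathbb{V},\mathbb{A})$ be a directed rooted tree (arborescence) with vertices $\mathbb{V}=\{1,\dots,N\}$ and arcs $\mathbb{A}=\{a_1,\dots,a_M\}$ directed away from the root $R\in\mathbb{V}$. Each vertex $i$ has a symmetric matrix $B_i\in\mathbb{R}^{n_i\times n_i}$; each arc $a_k=(i,j)$ has a symmetric matrix $D_k\in\mathbb{R}^{\ell_k\times \ell_k}$ and coupling matrices $C_k^+\in\mathbb{R}^{\ell_k\times n_i}$, $C_k^-\in\mathbb{R}^{\ell_k\times n_j}$. Put $\mathcal{B}=\mathrm{blkdiag}(B_1,\dots,B_N)$, $\mathcal{D}=\mathrm{blkdiag}(D_1,\dots,D_M)$, and let $\mathcal{C}=(\mathcal{C}_{k,i})$ be the block matrix (block rows $k\in\{1,\dots,M\}$, block columns $i\in\mathbb{V}$) with $\mathcal{C}_{k,i}=C_k^+$ if $i$ is the tail of $a_k$, $\mathcal{C}_{k,i}=-C_k^-$ if $i$ is the head of $a_k$, and $\mathcal{C}_{k,i}=0$ otherwise (an arc $(i,j)$ has tail $i$ and head $j$). The symmetric matrix $\mathcal{S}$ has rows and columns naturally indexed by arcs (with $\ell_k$ rows/columns for arc $a_k$). An inner vertex is a vertex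 with at least one outgoing arc. Group the arcs by their tails: for inner vertices $i,j$ let $\mathcal{S}_{i,j}$ be the submatrix of $\mathcal{S}$ with rows belonging to the outgoing arcs of $i$ and columns belonging to the outgoing arcs of $j$. After ordering the arcs accordingly, $\mathcal{S}=(\mathcal{S}_{i,j})_{i,j\text{ inner}}$, and $\mathcal{S}_{\mathrm{diag}}$ is the block-diagonal matrix with diagonal blocks $\mathcal{S}_{i,i}$, $i$ ranging over the inner vertices. *)

(* Defs.v *)
From HB Require Import structures.
From mathcomp Require Import all_boot all_order all_algebra.
From mathcomp Require Import complex.
From mathcomp Require Import boolp classical_sets reals.
Set Implicit Arguments.
Unset Strict Implicit.
Unset Printing Implicit Defensive.
Import Order.TTheory GRing.Theory Num.Theory.
Local Open Scope ring_scope.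

Definition arc_tail N M (arc : 'I_M -> 'I_N * 'I_N) (k : 'I_M) : 'I_N := (arc k).1.

Definition arc_head N M (arc : 'I_M -> 'I_N * 'I_N) (k : 'I_M) : 'I_N := (arc k).2.

Definition arc_rel N M (arc : 'I_M -> 'I_N * 'I_N) : rel 'I_N :=
  fun i j => [exists k, arc k == (i, j)].

(* The arcs form a set (no parallel arcs), and every vertex is reached from
   the root by exactly one directed walk.  In a finite digraph this excludes
   cycles, whether directed or not. *)
Definition arborescence N M (arc : 'I_M -> 'I_N * 'I_N) (root : 'I_N) : Prop :=
  injective arc /\
  forall v : 'I_N, exists! p : seq 'I_N,
    path (arc_rel arc) root p /\ last root p = v.

(* [conform_mx 0 A] is [A] transported to the expected dimensions: in each
   branch these agree with those of [A] by the test guarding it. *)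
Definition coupling_block (R : realType) N M (arc : 'I_M -> 'I_N * 'I_N)
    (n : 'I_N -> nat) (l : 'I_M -> nat)
    (Cp : forall k, 'M[R]_(l k, n (arc_tail arc k)))
    (Cm : forall k, 'M[R]_(l k, n (arc_head arc k)))
    (k : 'I_M) (i : 'I_N) : 'M[R]_(l k, n i) :=
  if i == arc_tail arc k then conform_mx 0 (Cp k)
  else if i == arc_head arc k then - conform_mx 0 (Cm k)
  else 0.

Definition coupling_mx (R : realType) N M (arc : 'I_M -> 'I_N * 'I_N)
    (n : 'I_N -> nat) (l : 'I_M -> nat)
    (Cp : forall k, 'M[R]_(l k, n (arc_tail arc k)))
    (Cm : forall k, 'M[R]_(l k, n (arc_head arc k))) :
    'M[R]_(\sum_k l k, \sum_i n i) :=
  \mxblock_(k, i) coupling_block Cp Cm k i.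

Definition schur_mx (R : realType) N M (arc : 'I_M -> 'I_N * 'I_N)
    (n : 'I_N -> nat) (l : 'I_M -> nat)
    (B : forall i, 'M[R]_(n i)) (D : forall k, 'M[R]_(l k))
    (Cp : forall k, 'M[R]_(l k, n (arc_tail arc k)))
    (Cm : forall k, 'M[R]_(l k, n (arc_head arc k))) : 'M[R]_(\sum_k l k) :=
  coupling_mx Cp Cm *m invmx (\mxdiag_i B i) *m (coupling_mx Cp Cm)^T
  + \mxdiag_k D k.

Definition posdefmx (R : realType) m (A : 'M[R]_m) : Prop :=
  A \is symmetricmx /\
  forall x : 'cV[R]_m, x != 0 -> 0 < (x^T *m A *m x) ord0 ord0.

Definition out_arcs N M (arc : 'I_M -> 'I_N * 'I_N) (i : 'I_N) : {set 'I_M} :=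
  [set k | arc_tail arc k == i].

Definition inner_vertices N M (arc : 'I_M -> 'I_N * 'I_N) : {set 'I_N} :=
  [set i | out_arcs arc i != finset.set0].

Definition out_size N M (arc : 'I_M -> 'I_N * 'I_N) (l : 'I_M -> nat)
    (i : 'I_N) : nat :=
  (\sum_(p < #|out_arcs arc i|) l (enum_val p))%N.

(* The block S_{i,j}: rows of the outgoing arcs of i, columns of the outgoing
   arcs of j, each family of arcs being taken in increasing order. *)
Definition tail_block (R : realType) N M (arc : 'I_M -> 'I_N * 'I_N)
    (l : 'I_M -> nat) (S : 'M[R]_(\sum_k l k)) (i j : 'I_N) :
    'M[R]_(out_size arc l i, out_size arc l j) :=
  \mxblock_(p < #|out_arcs arc i|, q < #|out_arcs arc j|)
    submxblock S (enum_val p) (enum_val q).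

(* S after the arcs have been reordered so as to be grouped by tail. *)
Definition grouped_mx (R : realType) N M (arc : 'I_M -> 'I_N * 'I_N)
    (l : 'I_M -> nat) (S : 'M[R]_(\sum_k l k)) :
    'M[R]_(\sum_(a < #|inner_vertices arc|) out_size arc l (enum_val a)) :=
  \mxblock_(a < #|inner_vertices arc|, b < #|inner_vertices arc|)
    tail_block arc S (enum_val a) (enum_val b).

Definition grouped_diag_mx (R : realType) N M (arc : 'I_M -> 'I_N * 'I_N)
    (l : 'I_M -> nat) (S : 'M[R]_(\sum_k l k)) :
    'M[R]_(\sum_(a < #|inner_vertices arc|) out_size arc l (enum_val a)) :=
  \mxdiag_(a < #|inner_vertices arc|) tail_block arc S (enum_val a) (enum_val a).

(* Largest modulus of a complex eigenvalue; 0 for the matrix of size 0. *)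
Definition spectral_radius (R : realType) m (A : 'M[R]_m) : R :=
  sup [set r : R | exists2 z : R[i],
         eigenvalue (map_mx (real_complex R) A) z & r = Normc.normc z]%classic.

(* The set of moduli is bounded, so that [sup] does not take its junk value. *)
Lemma spectral_radius_ub (R : realType) m (A : 'M[R]_m) (z : R[i]) :
  eigenvalue (map_mx (real_complex R) A) z -> Normc.normc z <= spectral_radius A.
Proof.
move=> ez; apply: ub_le_sup; last by exists z.
set B := map_mx _ A in ez *.
have [s es] : {s | char_poly B = lead_coef (char_poly B) *: \prod_(w <- s) ('X - w%:P)}.
  exact: closed_field_poly_normal.
exists (\sum_(w <- s) Normc.normc w) => r [w ew ->].
have ws : w \in s.
  move: ew; rewrite eigenvalue_root_char es.
  by rewrite (monicP (char_poly_monic B)) scale1r root_prod_XsubC.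
have nn u : 0 <= Normc.normc u :> R by case: u => a b; apply: sqrtr_ge0.
by rewrite (big_rem w) //= lerDl sumr_ge0.
Qed.

(* Main.v *)
Require Import Defs.
From HB Require Import structures.
From mathcomp Require Import all_boot all_order all_algebra.
From mathcomp Require Import complex.
From mathcomp Require Import boolp classical_sets reals.
From mathcomp Require Import lra.
Set Implicit Arguments.
Unset Strict Implicit.
Unset Printing Implicit Defensive.
Import Order.TTheory GRing.Theory Num.Theory.
Local Open Scope ring_scope.

(** Write G for S with its arcs grouped by tail and P for its block diagonal.
    Two distinct arcs contribute a nonzero block to S only if they share a
    vertex, because B is block diagonal.  In an arborescence two distinct arcs
    never share their head, so arcs with different tails that share a vertex
    are consecutive and the depths of their tails differ by one.  Hence every
    nonzero off-diagonal block of G joins a vertex of even depth to a vertex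
    of odd depth: the grouped matrix is block bipartite.  If E is the diagonal
    matrix with sign (-1)^depth on each block, then conjugating by E keeps P
    and flips the sign of G - P ([grouped_mx_signE]):
<<
      E G E^T = 2 P - G.
>>
    Since G is positive definite, so is 2 P - G.  These are the two strict
    inequalities - P < P - G < P between quadratic forms, and they bound the
    iteration matrix 1 - P^-1 G = P^-1 (P - G)
    ([splitting_spectral_radius]): it is self-adjoint for the inner product
    given by P, so its eigenvalues are real, and they are Rayleigh quotients
    of P - G against P, which lie strictly between -1 and 1.  As there are
    finitely many eigenvalues, their supremum is also below 1
    ([spectral_radius_lt]).

    The grouped matrix is handled through the injection [ungroup] of its
    indices into those of S, so that G is a principal submatrix of S. *)

(** * Spectral radius and complex eigenvectors of real matrices *)

(** A strict bound on each eigenvalue survives the supremum because the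
    eigenvalues are the finitely many roots of the characteristic polynomial.
    The hypothesis [0 < c] accounts for the matrix of size 0, whose spectral
    radius is 0. *)
Lemma spectral_radius_lt (R : realType) m (A : 'M[R]_m) (c : R) :
  0 < c ->
  (forall z : R[i], eigenvalue (map_mx (real_complex R) A) z ->
     Normc.normc z < c) ->
  spectral_radius A < c.
Proof.
move=> c0 eig_lt; rewrite /spectral_radius; set AC := map_mx _ A in eig_lt *.
have [s char_s] := closed_field_poly_normal (char_poly AC).
have mem_s z : eigenvalue AC z = (z \in s).
  rewrite eigenvalue_root_char char_s.
  by rewrite (monicP (char_poly_monic AC)) scale1r root_prod_XsubC.
set E := (X in sup X).
apply: (@le_lt_trans _ _ (\big[Num.max/0]_(z <- s) Normc.normc z)); last first.
  by rewrite big_seq; apply: bigmax_lt => // z; rewrite -mem_s; apply: eig_lt.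
have [->|/set0P E0] := eqVneq E set0; first by rewrite sup0 bigmax_ge_id.
apply: ge_sup => // r [z]; rewrite mem_s => zs ->.
exact: le_bigmax_seq.
Qed.

Lemma real_eigenvector (R : realType) m (A : 'M[R]_m) (z : R[i]) :
  eigenvalue (map_mx (real_complex R) A) z ->
  exists a b : 'rV[R]_m,
    [/\ (a != 0) || (b != 0),
        a *m A = complex.Re z *: a - complex.Im z *: b &
        b *m A = complex.Re z *: b + complex.Im z *: a].
Proof.
case/eigenvalueP => v vA v0.
exists (map_mx (@complex.Re R) v), (map_mx (@complex.Im R) v); split.
- apply: contraNT v0; rewrite negb_or !negbK => /andP[/eqP a0 /eqP b0].
  apply/eqP/rowP => j; move/rowP/(_ j): a0; move/rowP/(_ j): b0; rewrite !mxE.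
  by case: (v 0 j) => x y /= -> ->.
- apply/rowP => j; move/rowP/(_ j): vA; rewrite !mxE => /(congr1 (@complex.Re R)).
  rewrite raddf_sum /= => vAj.
  rewrite (eq_bigr (fun k => complex.Re (v 0 k * map_mx (real_complex R) A k j))).
    by rewrite vAj; case: z {vAj} (v 0 j) => p q [x y].
  by move=> k _; rewrite !mxE; case: (v 0 k) => x y /=; rewrite mulr0 subr0.
- apply/rowP => j; move/rowP/(_ j): vA; rewrite !mxE => /(congr1 (@complex.Im R)).
  rewrite raddf_sum /= => vAj.
  rewrite (eq_bigr (fun k => complex.Im (v 0 k * map_mx (real_complex R) A k j))).
    by rewrite vAj; case: z {vAj} (v 0 j) => p q [x y] /=.
  by move=> k _; rewrite !mxE; case: (v 0 k) => x y /=; rewrite mulr0 add0r.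
Qed.

(** * Positive definite matrices *)

Lemma posdefmx_tr (R : realType) m (A : 'M[R]_m) : posdefmx A -> A^T = A.
Proof.
by case=> /is_hermitianmxP; rewrite expr0 scale1r map_mx_id // => <-.
Qed.

Lemma posdefmx_row (R : realType) m (A : 'M[R]_m) (u : 'rV[R]_m) :
  posdefmx A -> u != 0 -> 0 < (u *m A *m u^T) 0 0.
Proof.
move=> [_ Apos] u0; have := Apos u^T; rewrite trmxK; apply.
by apply: contra_neq u0 => /(congr1 trmx); rewrite trmxK trmx0.
Qed.

Lemma posdefmx_intro (R : realType) m (A : 'M[R]_m) : A^T = A ->
  (forall u : 'rV[R]_m, u != 0 -> 0 < (u *m A *m u^T) 0 0) -> posdefmx A.
Proof.
move=> At Apos; split.
  by apply/is_hermitianmxP; rewrite expr0 scale1r map_mx_id // At.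
move=> x x0; have := Apos x^T; rewrite trmxK; apply.
by apply: contra_neq x0 => /(congr1 trmx); rewrite trmxK trmx0.
Qed.

Lemma posdefmx_unit (R : realType) m (A : 'M[R]_m) : posdefmx A -> A \in unitmx.
Proof.
move=> Apos; rewrite -row_free_unit -kermx_eq0; apply/rowV0P => u /sub_kermxP uA.
apply/eqP/negPn/negP => u0; have := posdefmx_row Apos u0.
by rewrite uA mul0mx mxE ltxx.
Qed.

Lemma posdefmx_congr (R : realType) m p (A : 'M[R]_m) (E : 'M[R]_(p, m)) :
  row_free E -> posdefmx A -> posdefmx (E *m A *m E^T).
Proof.
move=> Efree Apos; apply: posdefmx_intro.
  by rewrite !trmx_mul trmxK (posdefmx_tr Apos) mulmxA.
move=> u u0; rewrite !mulmxA -(mulmxA _ E^T) -trmx_mul.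
apply: posdefmx_row => //; apply: contra_neq u0 => uE.
by apply: (row_free_inj Efree); rewrite uE mul0mx.
Qed.

Lemma posdefmx_mxsub (R : realType) m p (A : 'M[R]_m) (f : 'I_p -> 'I_m) :
  injective f -> posdefmx A -> posdefmx (mxsub f f A).
Proof.
move=> f_inj Apos.
have -> : mxsub f f A = rowsub f 1%:M *m A *m (rowsub f 1%:M)^T.
  rewrite -rowsubE trmx_mxsub trmx1 mulmx_colsub mulmx1.
  by apply/matrixP => i j; rewrite !mxE.
apply: posdefmx_congr => //; apply/row_freeP; exists (rowsub f 1%:M)^T.
rewrite -rowsubE; apply/matrixP => i j; rewrite !mxE.
by rewrite eq_sym (inj_eq f_inj) eq_sym.
Qed.

(** * Convergence of a symmetric splitting *)

(** With c + i d the complex row vector obtained from a left eigenvector by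
    multiplying with P^-1, the eigenvalue equation for x + i y reads
    (c + i d)(P - G) = (x + i y)(c + i d) P.  Testing it against c and d, and
    using the symmetry of P and P - G to cancel the mixed terms, gives
    y (cPc + dPd) = 0 and c(P - G)c + d(P - G)d = x (cPc + dPd).  Positivity of
    the forms P, G and 2 P - G then yields y = 0 and -1 < x < 1. *)
Lemma splitting_spectral_radius (R : realType) m (P G : 'M[R]_m) :
  posdefmx G -> posdefmx (P + P - G) ->
  spectral_radius (1%:M - invmx P *m G) < 1.
Proof.
move=> Gpos Hpos.
have Pt : P^T = P.
  have /posdefmx_tr := Hpos; rewrite !linearD linearN /= (posdefmx_tr Gpos).
  move=> /addIr; rewrite -!mulr2n -!scaler_nat => /scalerI; apply.
  by rewrite pnatr_eq0.
pose q (A : 'M[R]_m) (u v : 'rV[R]_m) := (u *m A *m v^T) 0 0 : R.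
have qC A u v : A^T = A -> q A u v = q A v u.
  move=> At; rewrite /q; transitivity ((u *m A *m v^T)^T 0 0).
    by rewrite [RHS]mxE.
  by rewrite !trmx_mul trmxK At mulmxA.
have qDm A B u v : q (A + B) u v = q A u v + q B u v.
  by rewrite /q mulmxDr mulmxDl mxE.
have qNm A u v : q (- A) u v = - q A u v.
  by rewrite /q mulmxN mulNmx mxE.
have qsum_gt0 A u v : posdefmx A -> (u != 0) || (v != 0) -> 0 < q A u u + q A v v.
  move=> Apos.
  have q_ge0 w : 0 <= q A w w.
    have [->|/(posdefmx_row Apos)/ltW//] := eqVneq w 0.
    by rewrite /q mul0mx mul0mx mxE.
  by case/orP => /(posdefmx_row Apos) pos; [apply: ltr_wpDr|apply: ltr_wpDl].
(* P is the average of G and P + P - G. *)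
have Ppos : posdefmx P.
  apply: posdefmx_intro => // u u0.
  have := posdefmx_row Gpos u0; have := posdefmx_row Hpos u0.
  rewrite -/(q G u u) -/(q P u u) -/(q (P + P - G) u u) !qDm qNm; lra.
have Punit := posdefmx_unit Ppos.
apply: spectral_radius_lt => // z /real_eigenvector[a [b [ab0 eqa eqb]]].
pose c := a *m invmx P; pose d := b *m invmx P.
have ac : a = c *m P by rewrite mulmxKV.
have bd : b = d *m P by rewrite mulmxKV.
have cd0 : (c != 0) || (d != 0).
  apply: contraTT ab0; rewrite !negb_or !negbK => /andP[/eqP c0 /eqP d0].
  by rewrite ac bd c0 d0 !mul0mx eqxx.
set x := complex.Re z in eqa eqb; set y := complex.Im z in eqa eqb.
have eqc : c *m (P - G) = x *: (c *m P) - y *: (d *m P).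
  by rewrite -ac -bd -eqa mulmxBr mulmxBr mulmx1 mulmxA -ac.
have eqd : d *m (P - G) = x *: (d *m P) + y *: (c *m P).
  by rewrite -ac -bd -eqb mulmxBr mulmxBr mulmx1 mulmxA -bd.
have qc w : q (P - G) c w = x * q P c w - y * q P d w.
  by rewrite [LHS]/q eqc mulmxBl -!scalemxAl mxE [X in X + _]mxE [X in _ + X]mxE [X in - X]mxE.
have qd w : q (P - G) d w = x * q P d w + y * q P c w.
  by rewrite [LHS]/q eqd mulmxDl -!scalemxAl mxE [X in X + _]mxE [X in _ + X]mxE.
have PGt : (P - G)^T = P - G by rewrite linearB /= Pt (posdefmx_tr Gpos).
have := qsum_gt0 _ _ _ Ppos cd0; have := qsum_gt0 _ _ _ Gpos cd0.
have := qsum_gt0 _ _ _ Hpos cd0.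
have := qC _ c d PGt; have := qc c; have := qd d; rewrite (qc d) (qd c).
rewrite !qDm !qNm (qC _ d c Pt).
move=> e1 e2 e3 H1 H2 H3.
have y0 : y = 0.
  have : y * (q P c c + q P d d) = 0 by lra.
  by move/eqP; rewrite mulf_eq0 (gt_eqF H3) orbF => /eqP.
have -> : Normc.normc z = `|x|.
  by move: y0; rewrite /x /y; case: (z) => p r /= ->; rewrite expr0n addr0 sqrtr_sqr.
rewrite y0 in e1 e2.
rewrite ltr_norml -(ltr_pM2r H3) -[x < 1](ltr_pM2r H3); apply/andP; split; lra.
Qed.

(** * Arborescences *)

(** The walk from the root to the head of an arc is, by uniqueness, the walk to
    its tail followed by the arc. *)
Lemma arborescence_depth N M (arc : 'I_M -> 'I_N * 'I_N) (root : 'I_N) :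
  arborescence arc root ->
  exists depth : 'I_N -> nat,
    forall k, depth (arc_head arc k) = (depth (arc_tail arc k)).+1.
Proof.
move=> [_ walk_uniq].
have [walk walkP] := boolp.choice walk_uniq.
exists (fun v => size (walk v)) => k.
have [[tail_path tail_last] _] := walkP (arc_tail arc k).
have [_ /(_ (rcons (walk (arc_tail arc k)) (arc_head arc k)))] :=
  walkP (arc_head arc k).
move=> -> //; first by rewrite size_rcons.
split; last by rewrite last_rcons.
rewrite rcons_path tail_path tail_last; apply/existsP; exists k.
by rewrite /arc_tail /arc_head -surjective_pairing.
Qed.

(** Two arcs with the same head would extend the walks to their tails to walks
    with the same endpoint; these agree, hence so do the tails, and there are
    no parallel arcs. *)
Lemma arborescence_head_inj N M (arc : 'I_M -> 'I_N * 'I_N) (root : 'I_N) :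
  arborescence arc root -> injective (arc_head arc).
Proof.
move=> [arc_inj walk_uniq] k k' eq_head; apply: arc_inj.
rewrite [arc k]surjective_pairing [arc k']surjective_pairing.
rewrite -/(arc_head arc k) -/(arc_head arc k') eq_head; congr (_, _).
have arc_walk j : exists p,
    [/\ path (arc_rel arc) root (rcons p (arc_head arc j)) & last root p = (arc j).1].
  have [p [[p_path p_last] _]] := walk_uniq (arc j).1.
  exists p; split=> //; rewrite rcons_path p_path p_last; apply/existsP; exists j.
  by rewrite /arc_head -surjective_pairing.
have [p [p_path <-]] := arc_walk k; have [p' [p'_path <-]] := arc_walk k'.
have [w [_ w_uniq]] := walk_uniq (arc_head arc k').
have := w_uniq (rcons p (arc_head arc k)).
rewrite last_rcons => /(_ (conj p_path eq_head)) w1.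
have := w_uniq (rcons p' (arc_head arc k')).
rewrite last_rcons => /(_ (conj p'_path erefl)); rewrite w1.
by move/rcons_inj => [->].
Qed.

(** * Sparsity of the Schur complement *)

(** The diagonal blocks X_ii of the inverse satisfy X_ii B_i = 1, which makes
    each B_i invertible; the block diagonal matrix of their inverses is then
    checked to be the inverse. *)
Lemma invmx_mxdiag (R : fieldType) N (n : 'I_N -> nat) (B : forall i, 'M[R]_(n i)) :
  \mxdiag_i B i \in unitmx -> invmx (\mxdiag_i B i) = \mxdiag_i invmx (B i).
Proof.
move=> Bunit; set X := invmx _.
have XB : \mxblock_(i, j) (submxblock X i j *m B j) = \mxdiag_i (1%:M : 'M_(n i)).
  by rewrite -mul_mxblock_mxdiag submxblockK mulVmx // mxdiagZ.
have Bi_unit i : B i \in unitmx.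
  have := congr1 (fun A => submxblock A i i) XB.
  by rewrite mxblockK submxblock_diag => /mulmx1_unit[].
rewrite -[RHS](mulKmx Bunit) -/X /mxdiag mul_mxblock.
rewrite -[LHS]mulmx1 -mxdiagZ; congr (_ *m _); apply/eq_mxblock => i j.
rewrite (bigD1 i) //= eqxx conform_mx_id big1 ?addr0; last first.
  by move=> h /negPf hi; rewrite eq_sym hi mul0mx.
by case: eqVneq => [->|]; rewrite ?mulmx0 // !conform_mx_id mulmxV.
Qed.

(** Block (k, k') of C B^-1 C^T is the sum over vertices i of
    C_ki B_i^-1 C_k'i^T, and C_ki vanishes unless i is an endpoint of arc k. *)
Lemma schur_mx_sparse (R : realType) N M (arc : 'I_M -> 'I_N * 'I_N)
    (n : 'I_N -> nat) (l : 'I_M -> nat)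
    (B : forall i, 'M[R]_(n i)) (D : forall k, 'M[R]_(l k))
    (Cp : forall k, 'M[R]_(l k, n (arc_tail arc k)))
    (Cm : forall k, 'M[R]_(l k, n (arc_head arc k))) (k k' : 'I_M) :
  \mxdiag_i B i \in unitmx -> k != k' ->
  arc_tail arc k != arc_tail arc k' -> arc_tail arc k != arc_head arc k' ->
  arc_head arc k != arc_tail arc k' -> arc_head arc k != arc_head arc k' ->
  submxblock (schur_mx B D Cp Cm) k k' = 0.
Proof.
move=> Bunit kk' tt th ht hh.
rewrite /schur_mx /coupling_mx invmx_mxdiag // mul_mxblock_mxdiag tr_mxblock.
rewrite mul_mxblock submxblockD !mxblockK (negPf kk') addr0 big1 // => i _.
rewrite /coupling_block.
have [->|ik] := eqVneq i (arc_tail arc k).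
  by rewrite (negPf tt) (negPf th) trmx0 mulmx0.
have [->|ik'] := eqVneq i (arc_head arc k).
  by rewrite (negPf ht) (negPf hh) trmx0 mulmx0.
by rewrite !mul0mx.
Qed.

(** * Grouping the arcs by tail *)

Section Grouping.
Variables (R : realType) (N M : nat) (arc : 'I_M -> 'I_N * 'I_N).
Variables (l : 'I_M -> nat) (S : 'M[R]_(\sum_k l k)).

Let grouped_size := (\sum_(a < #|inner_vertices arc|) out_size arc l (enum_val a))%N.

(** Position t inside the block of vertex i names an outgoing arc of i and a
    coordinate of that arc; this is the corresponding index of S. *)
Definition ungroup_in (i : 'I_N) (t : 'I_(out_size arc l i)) : 'I_(\sum_k l k) :=
  tagnat.Rank (enum_val (tagnat.sig1 t)) (tagnat.sig2 t).

Definition ungroup (r : 'I_grouped_size) : 'I_(\sum_k l k) :=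
  ungroup_in (tagnat.sig2 r).

Lemma grouped_mxE : grouped_mx arc S = mxsub ungroup ungroup S.
Proof. by apply/matrixP => r s; rewrite !mxE. Qed.

Lemma tail_ungroup r :
  arc_tail arc (tagnat.sig1 (ungroup r)) = enum_val (tagnat.sig1 r).
Proof.
rewrite /ungroup /ungroup_in tagnat.Rank1K.
by have := enum_valP (tagnat.sig1 (tagnat.sig2 r)); rewrite inE => /eqP.
Qed.

Lemma ungroup_in_inj i : injective (@ungroup_in i).
Proof.
move=> t u /(congr1 val)/eqP; rewrite /ungroup_in /= tagnat.eq_Rank.
rewrite -[RHS]tagnat.sig2K -[LHS]tagnat.sig2K.
move: (tagnat.sig1 t) (tagnat.sig2 t) (tagnat.sig1 u) (tagnat.sig2 u) => p x q y.
case/andP => /eqP/enum_val_inj epq; case: q / epq y => y /eqP/val_inj -> //.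
Qed.

(** The index of S determines the arc, whose tail determines the block; inside
    a block, [ungroup_in_inj] applies. *)
Lemma ungroup_inj : injective ungroup.
Proof.
move=> r s eq_rs.
have : enum_val (tagnat.sig1 r) = enum_val (tagnat.sig1 s).
  by rewrite -!tail_ungroup eq_rs.
move/enum_val_inj => eq_a; rewrite -[LHS]tagnat.sig2K -[RHS]tagnat.sig2K.
move: eq_rs eq_a; rewrite /ungroup.
move: (tagnat.sig1 r) (tagnat.sig2 r) (tagnat.sig1 s) (tagnat.sig2 s) => a t b u.
by move=> + eab; case: b / eab u => u /ungroup_in_inj ->.
Qed.

Lemma grouped_diag_mxE r s :
  grouped_diag_mx arc S r s =
  if tagnat.sig1 r == tagnat.sig1 s then grouped_mx arc S r s else 0.
Proof.
rewrite mxE [grouped_mx _ _ _ _]mxE.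
move: (tagnat.sig1 r) (tagnat.sig2 r) (tagnat.sig1 s) (tagnat.sig2 s) => a t b u.
by case: eqVneq u => [<-|ab] u; rewrite ?conform_mx_id // mxE.
Qed.

(** If the nonzero blocks between distinct tails only join tails of different
    colors, a sign change on one color class negates all the off-diagonal
    blocks and fixes the diagonal ones. *)
Lemma grouped_mx_signE (color : 'I_N -> bool) :
  (forall k k', color (arc_tail arc k) = color (arc_tail arc k') ->
     arc_tail arc k != arc_tail arc k' -> submxblock S k k' = 0) ->
  let E := diag_mx (\row_r (-1) ^+ color (enum_val (tagnat.sig1 r))) in
  E *m grouped_mx arc S *m E^T =
  grouped_diag_mx arc S + grouped_diag_mx arc S - grouped_mx arc S.
Proof.
move=> S0 E; apply/matrixP => r s.
have G0 : tagnat.sig1 r != tagnat.sig1 s ->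
    color (enum_val (tagnat.sig1 r)) = color (enum_val (tagnat.sig1 s)) ->
    grouped_mx arc S r s = 0.
  rewrite -(inj_eq enum_val_inj) -!tail_ungroup => rs eq_color.
  rewrite grouped_mxE mxE -[ungroup r]tagnat.sig2K -[ungroup s]tagnat.sig2K.
  move/matrixP: (S0 _ _ eq_color rs) => /(_ (tagnat.sig2 _) (tagnat.sig2 _)).
  by rewrite !mxE.
move: G0 (grouped_diag_mxE r s); move: (grouped_mx arc S) (grouped_diag_mx arc S).
move=> G Gd G0 GdE; rewrite tr_diag_mx mul_mx_diag mul_diag_mx !mxE {}GdE.
case: eqVneq G0 => [->|_ /(_ isT)] G0.
  by rewrite addrK mulrAC -expr2 sqrr_sign mul1r.
rewrite !add0r; move: G0.
by case: (color _) (color _) => [] [] => [->//|_|_|->//] /=;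
  rewrite ?expr0 ?expr1 ?mulr0 ?mul0r ?oppr0 ?mul1r ?mulr1 ?mulN1r ?mulrN1.
Qed.
End Grouping.

(** * The block Jacobi iteration on a tree *)

Theorem theorem4p1 (R : realType) (N M : nat)
    (arc : 'I_M -> 'I_N * 'I_N) (root : 'I_N)
    (tree : arborescence arc root)
    (n : 'I_N -> nat) (l : 'I_M -> nat)
    (B : forall i : 'I_N, 'M[R]_(n i))
    (D : forall k : 'I_M, 'M[R]_(l k))
    (Cp : forall k : 'I_M, 'M[R]_(l k, n (arc_tail arc k)))
    (Cm : forall k : 'I_M, 'M[R]_(l k, n (arc_head arc k)))
    (B_sym : forall i : 'I_N, B i \is symmetricmx)
    (D_sym : forall k : 'I_M, D k \is symmetricmx)
    (B_inv : \mxdiag_i B i \in unitmx)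
    (S_posdef : posdefmx (schur_mx B D Cp Cm)) :
  spectral_radius
    (1%:M - invmx (grouped_diag_mx arc (schur_mx B D Cp Cm))
            *m grouped_mx arc (schur_mx B D Cp Cm)) < 1.
Proof.
have [depth depthE] := arborescence_depth tree.
have head_inj := arborescence_head_inj tree.
have Gpos : posdefmx (grouped_mx arc (schur_mx B D Cp Cm)).
  by rewrite grouped_mxE; apply: posdefmx_mxsub => //; apply: ungroup_inj.
apply: splitting_spectral_radius => //.
rewrite -(@grouped_mx_signE _ _ _ _ _ _ (odd \o depth)) /=; last first.
  (* Equal parity of depth excludes consecutive arcs. *)
  move=> k k' eq_depth tt.
  have kk' : k != k' by apply: contra_neq tt => ->.
  apply: schur_mx_sparse => //.
  - apply/eqP => th; move: eq_depth; rewrite th depthE /=.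
    by case: (odd _).
  - apply/eqP => ht; move: eq_depth; rewrite -ht depthE /=.
    by case: (odd _).
  - by rewrite (inj_eq head_inj).
apply: posdefmx_congr => //; rewrite row_free_unit unitmxE det_diag.
by rewrite rpred_prod // => r _; rewrite mxE unitrX // unitrN1.
Qed.
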